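(* Let $0<\delta<1$ and, for $u,v\in\mathcal{S}^{\rm qnl}_\delta(\Omega)$, let $$b^{\rm qnl}_\delta(u,v)=\iint_{x\le 0\text{ or }y\le 0}\gamma_\delta(|y-x|)(u(y)-u(x))(v(y)-v(x))\,dy\,dx+\int_{x>0}u'(x)v'(x)\,\omega_\delta(x)\,dx .$$ Then for every $u\in\mathcal{S}^{\rm qnl}_\delta(\Omega)$, $$b^{\rm qnl}_\delta(u,u)\ge\iint_{x,y\in\mathbb{R}}\gamma_\delta(|y-x|)\,(u(y)-u(x))^2\,dy\,dx .$$
   Context: $\Omega=(-1,1)$ and $\Omega_\delta=(-1-\delta,-1)\cup\{1\}$. The kernel is $\gamma_\delta(s)=\gamma_\delta(|s|)=\delta^{-3}\gamma(|s|/\delta)$ for $s\in\mathbb{R}$, where $\gamma\ge 0$ is nonincreasing on $(0,1)$, is supported in $[0,1]$ (i.e. $\gamma(r)=0$ for $r>1$), and satisfies $\int_{\mathbb{R}}|s|^2\gamma(|s|)\,ds=1$. The weight is $\omega_\delta(x)=\int_0^1 dt\int_{|s|<x/t}|s|^2\gamma_\delta(|s|)\,ds$ for $x>0$. Functions are extended by zero outside $\Omega\cup\Omega_\delta$, and $u'$ is the weak derivative on $(0,\infty)$. Set $|u|^2_{\mathcal{S}^{\rm qnl}_\delta(\Omega)}=b^{\rm qnl}_\delta(u,u)$ and $\|u\|^2_{\mathcal{S}^{\rm qnl}_\delta(\Omega)}=\|u\|^2_{L^2(\Omega\cup\Omega_\delta)}+|u|^2_{\mathcal{S}^{\rm qnl}_\delta(\Omega)}$.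 The energy space $\mathcal{S}^{\rm qnl}_\delta(\Omega)$ is the completion of $C_c^\infty(\Omega)$ in this norm, i.e. the set of $u\in L^2(\Omega\cup\Omega_\delta)$ for which there are $u_n\in C_c^\infty(\Omega)$ with $\|u_n-u\|_{\mathcal{S}^{\rm qnl}_\delta(\Omega)}\to 0$. *)

(* Defs.v *)
From HB Require Import structures.
From mathcomp Require Import all_boot all_order all_algebra.
From mathcomp Require Import all_classical all_reals all_analysis.

Set Implicit Arguments.
Unset Strict Implicit.
Unset Printing Implicit Defensive.

Import Order.TTheory GRing.Theory Num.Theory.
Import numFieldNormedType.Exports.

Local Open Scope classical_set_scope.
Local Open Scope ring_scope.

Section weak_derivative.
Context {R : realType}.
Local Notation mu := (@lebesgue_measure R).

Definition smooth (f : R -> R) : Prop :=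
  forall (n : nat) (x : R), derivable (f^`(n))%classic x 1.

Definition Cc_infty (U : set R) (f : R -> R) : Prop :=
  [/\ smooth f,
      compact (closure [set x | f x != 0]) &
      closure [set x | f x != 0] `<=` U].

Definition is_weak_derivative (U : set R) (u g : R -> R) : Prop :=
  [/\ locally_integrable U u,
      locally_integrable U g &
      forall phi, Cc_infty U phi ->
        \int[mu]_(x in U) (u x * phi^`()%classic x) =
        - \int[mu]_(x in U) (g x * phi x)].

Definition weakly_derivable (U : set R) (u : R -> R) : Prop :=
  exists g, is_weak_derivative U u g.

(* A representative of the weak derivative of u on U; it is only determined
   almost everywhere on U, and is 0 by convention if u is not weakly
   derivable on U. *)
Definition weak_derivative (U : set R) (u : R -> R) : R -> R :=
  xget (fun=> 0) [set g | is_weak_derivative U u g].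

End weak_derivative.

Section quasinonlocal.
Context {R : realType}.
Local Notation mu := (@lebesgue_measure R).

Record kernel_profile (gamma : R -> R) : Prop := KernelProfile {
  kernel_ge0 : forall r : R, 0 <= r -> 0 <= gamma r ;
  kernel_nincr : forall r s : R, 0 < r -> r <= s -> s < 1 -> gamma s <= gamma r ;
  kernel_supp : forall r : R, 1 < r -> gamma r = 0 ;
  kernel_moment2 : (\int[mu]_s (`|s| ^+ 2 * gamma `|s|)%:E = 1)%E }.

Definition Omega : set R := `]-1, 1[.

Definition Omega_ (delta : R) : set R := `]-1 - delta, -1[ `|` [set 1].

Definition qnl_domain (delta : R) : set R := Omega `|` Omega_ delta.

Definition qnl_kernel (gamma : R -> R) (delta s : R) : R :=
  delta ^- 3 * gamma (`|s| / delta).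

(* t = 0 is left out because of the convention x / 0 = 0. *)
Definition qnl_weight (gamma : R -> R) (delta x : R) : \bar R :=
  (\int[mu]_(t in `]0%R, 1%R[)
     \int[mu]_(s in [set s : R | (`|s| < x / t)%R])
       (`|s| ^+ 2 * qnl_kernel gamma delta s)%:E)%E.

(* Functions on Omega `|` Omega_ delta are represented by their extension by
   zero to the real line.  The form is extended-real valued, hence total; it
   is finite on the energy space. *)
Definition bqnl (gamma : R -> R) (delta : R) (u v : R -> R) : \bar R :=
  let u' := weak_derivative `]0, +oo[ u in
  let v' := weak_derivative `]0, +oo[ v in
  (\int[mu \x mu]_(p in [set p : R * R | (p.1 <= 0)%R \/ (p.2 <= 0)%R])
     (qnl_kernel gamma delta `|p.2 - p.1| * (u p.2 - u p.1) * (v p.2 - v p.1))%:E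
   + \int[mu]_(x in `]0%R, +oo[) ((u' x * v' x)%:E * qnl_weight gamma delta x))%E.

Definition qnl_norm (gamma : R -> R) (delta : R) (u : R -> R) : \bar R :=
  sqrte (\int[mu]_(x in qnl_domain delta) (`|u x| ^+ 2)%:E
         + bqnl gamma delta u u)%E.

Definition L2 (D : set R) (u : R -> R) : Prop :=
  measurable_fun D u /\ (\int[mu]_(x in D) (`|u x| ^+ 2)%:E < +oo)%E.

(* qnl_norm involves u', so weak derivability on (0, oo) is part of the
   condition that the norms of u_ n - u make sense. *)
Definition qnl_space (gamma : R -> R) (delta : R) (u : R -> R) : Prop :=
  [/\ forall x, ~ qnl_domain delta x -> u x = 0,
      L2 (qnl_domain delta) u,
      weakly_derivable `]0, +oo[ u &
      exists2 u_ : nat -> R -> R,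
        forall n, Cc_infty Omega (u_ n) &
        qnl_norm gamma delta (u_ n \- u) @[n --> \oo] --> 0%E].

End quasinonlocal.

(* Main.v *)
Require Import Defs.
From mathcomp Require Import all_boot all_order all_algebra.
From mathcomp Require Import all_classical all_reals all_analysis.
From mathcomp Require Import measurable_realfun ring lra.

(** Both energies contain the nonlocal interaction of the pairs (x, y) with
    x <= 0 or y <= 0, so the inequality compares what is left on x, y > 0: the
    nonlocal energy of the positive quadrant and the Dirichlet energy of u' on
    (0, oo) weighted by omega_delta (lemma positive_quadrant_le).

    For x, y > 0 the increment u(y) - u(x) is the integral of u' over the segment
    from x to y, so by Cauchy-Schwarz its square is at most |y - x| times the
    integral of u'^2 over that segment (sqr_increment_le). Multiply by the kernel
    k, write y = x + s and exchange the order of integration: the point z > 0 is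
    charged with u'(z)^2 times the integral over s of k(s) |s| m(s, z), where
    m(s, z) is the measure of the set of x > 0 such that x + s > 0 and z lies
    between x and x + s. Such x fill an interval of length at most min(|s|, z).
    On the other side, exchanging the two integrals that define omega_delta(z)
    gives the integral over s of k(s) s^2 times the measure of the t in (0, 1)
    with |s| t < z, and s^2 min(1, z / |s|) = |s| min(|s|, z). Hence z is charged
    with at most u'(z)^2 omega_delta(z) (slice_comparison, qnl_weightE and
    integral_energy_density_le).

    The delicate point is the increment formula (weak_derivative_increment), since
    u' is known only through test functions. The formula is proved when x and y
    are Lebesgue points of u, which almost all points are: the test functions are
    smooth plateaus shrinking to the indicator of ]x, y], whose derivatives form
    approximate identities at x and at y. The plateaus are differences of
    dilations of a smooth step built from exp(-1/x). *)

Set Implicit Arguments.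
Unset Strict Implicit.
Unset Printing Implicit Defensive.

Import Order.TTheory GRing.Theory Num.Theory.
Import numFieldNormedType.Exports.

Local Open Scope classical_set_scope.
Local Open Scope ring_scope.

(** * A smooth step *)

Section smooth_step.
Context {R : realType}.
Implicit Types (f g : R -> R) (x t : R).

(** The family x^-n exp (-1/x) is indexed by n because differentiation maps it
    into its own span; n = 0 is the classical flat function. *)
Definition flat (n : nat) x : R :=
  if 0 < x then x^-1 ^+ n * expR (- x^-1) else 0.

Lemma flat_pos n x : 0 < x -> flat n x = x^-1 ^+ n * expR (- x^-1).
Proof. by rewrite /flat => ->. Qed.

Lemma flat_npos n x : x <= 0 -> flat n x = 0.
Proof. by rewrite /flat leNgt => /negbTE ->. Qed.

Lemma flat_ge0 n x : 0 <= flat n x.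
Proof.
rewrite /flat; case: ifPn => // x0.
by rewrite mulr_ge0 ?expR_ge0// exprn_ge0// invr_ge0 ltW.
Qed.

Lemma flat_gt0 n x : 0 < x -> 0 < flat n x.
Proof. by move=> x0; rewrite flat_pos// mulr_gt0 ?expR_gt0// exprn_gt0// invr_gt0. Qed.

(** One term of the exponential series beats the factor x^-n with a power to
    spare, so that flat n vanishes at 0 together with its difference quotients. *)
Lemma flat_le n x : flat n x <= n.+1`!%:R * `|x|.
Proof.
have [x0|x0] := leP x 0; first by rewrite flat_npos// mulr_ge0.
rewrite flat_pos// gtr0_norm// expRN ler_pdivrMr ?expR_gt0//.
have := @expR_ge1Dxn R x^-1 n; rewrite invr_ge0 => /(_ (ltW x0)) h.
have f0 : 0 < n.+1`!%:R :> R by rewrite ltr0n fact_gt0.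
have {h} : x^-1 ^+ n.+1 <= n.+1`!%:R * expR x^-1.
  rewrite mulrC -ler_pdivrMr//; apply: le_trans h.
  by rewrite lerDr.
rewrite exprS mulrC ler_pdivrMr//.
by rewrite mulrAC.
Qed.

Lemma flatS n x : flat n.+1 x = x^-1 * flat n x.
Proof. by rewrite /flat; case: ifP => // _; rewrite ?mulr0// exprS mulrA. Qed.

Lemma is_derive_flat n x :
  is_derive x 1 (flat n) (flat n.+2 x - n%:R * flat n.+1 x).
Proof.
have [x0|x0|->] := ltgtP x 0.
- rewrite !flat_npos ?ltW// mulr0 subr0.
  apply: (@near_eq_is_derive R R R (cst 0 : R -> R) _ x 1 0).
  by near=> y; rewrite /= flat_npos// ltW//; near: y; exact: lt_nbhsl.
- rewrite !flat_pos//.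
  apply: (@near_eq_is_derive _ _ _ ((fun t : R => t^-1) ^+ n * (fun t : R => expR (- t^-1)))).
    by near=> y; rewrite !fctE flat_pos//; near: y; exact: lt_nbhsr.
  have dV : is_derive x 1 (fun t : R => t^-1) (- x ^- 2).
    have := @is_deriveV R id x 1 1; rewrite /= gt_eqF// => /(_ isT (is_derive_id _ _)).
    by move/is_derive_eq; apply; rewrite scaler1.
  have dX := @is_deriveX R _ (fun t : R => t^-1) n x 1 _ dV.
  have dN := is_deriveN dV.
  have dE := @is_derive1_comp R expR (fun t => - t^-1) x _ _ (is_derive_expR _) dN.
  have dM := is_deriveM dX dE.
  apply: (is_derive_eq dM).
  rewrite !fctE /GRing.scale/= opprK.
  case: n {dX dE dM} => [|n] /=; rewrite ?expr0 !exprS; field; lra.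
- rewrite !flat_npos// mulr0 subr0.
  (* At 0 the difference quotient of flat n is flat n.+1 itself. *)
  have h0 : (fun h : R => h^-1 *: ((flat n \o shift 0) (h *: 1) - flat n 0)) @ 0^' --> (0 : R).
    apply/cvgr0Pnorm_le => e e0.
    near=> h; rewrite /= [h *: 1]mulr1 addr0 (flat_npos n (lexx _)) subr0 [_ *: _]mulrC mulrC.
    rewrite -flatS ger0_norm ?flat_ge0//; apply: (le_trans (flat_le _ _)).
    rewrite -ler_pdivlMl ?ltr0n ?fact_gt0//.
    near: h; apply: nbhs_dnbhs.
    have : 0 < (n.+2`!%:R)^-1 * e by rewrite mulr_gt0// invr_gt0 ltr0n fact_gt0.
    by move/(@nbhs0_le R R).
  apply: DeriveDef.
    by apply/cvg_ex; exists 0.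
  exact: (cvg_lim _ h0).
Unshelve. all: by end_near. Qed.

(** A syntactic class of functions closed under differentiation: every member
    is then smooth, without any Leibniz or Faa di Bruno formula for iterated
    derivatives. *)
Inductive flat_expr : (R -> R) -> Prop :=
| flat_expr_flat n : flat_expr (flat n)
| flat_expr_cst c : flat_expr (cst c)
| flat_expr_add f g : flat_expr f -> flat_expr g -> flat_expr (f + g)
| flat_expr_mul f g : flat_expr f -> flat_expr g -> flat_expr (f * g)
| flat_expr_inv f : (forall x, f x != 0) -> flat_expr f -> flat_expr (fun x => (f x)^-1)
| flat_expr_affine a b f : flat_expr f -> flat_expr (f \o (fun x => a * x + b)).

Lemma flat_expr_is_derive f : flat_expr f ->
  exists2 f', flat_expr f' & forall x, is_derive x 1 f (f' x).
Proof.
elim=> {f} [n|c|f g _ [f' ef' df] _ [g' eg' dg]|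
    f g ef [f' ef' df] eg [g' eg' dg]|f f0 ef [f' ef' df]|a b f ef [f' ef' df]].
- exists (flat n.+2 + cst (- n%:R) * flat n.+1).
    by apply: flat_expr_add; [|apply: flat_expr_mul; [exact: flat_expr_cst|]];
      exact: flat_expr_flat.
  move=> x; apply: (is_derive_eq (is_derive_flat n x)).
  by rewrite !fctE mulNr.
- by exists (cst 0) => [|x]; [exact: flat_expr_cst|exact: is_derive_cst].
- by exists (f' + g') => [|x]; [exact: flat_expr_add|exact: is_deriveD].
- exists (f * g' + g * f') => [|x].
    by apply: flat_expr_add; exact: flat_expr_mul.
  exact: is_deriveM.
- exists (cst (-1) * ((fun x => (f x)^-1) * (fun x => (f x)^-1)) * f') => [|x].
    apply: flat_expr_mul => //; apply: flat_expr_mul; first exact: flat_expr_cst.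
    by apply: flat_expr_mul; exact: flat_expr_inv.
  apply: (is_derive_eq (is_deriveV (f0 x) (df x))).
  by rewrite !fctE /GRing.scale/= mulN1r -invfM -expr2.
- exists (cst a * (f' \o (fun x => a * x + b))) => [|x].
    by apply: flat_expr_mul; [exact: flat_expr_cst|exact: flat_expr_affine].
  have da : is_derive x 1 (fun t => a * t + b) a.
    have h := is_deriveD (is_deriveZ a (is_derive_id x 1)) (is_derive_cst b x 1).
    apply: (is_derive_eq h); by rewrite /= addr0 [_ *: _]mulr1.
  apply: (is_derive_eq (@is_derive1_comp R f _ x _ _ (df _) da)).
  by rewrite !fctE mulrC.
Qed.

Lemma flat_expr_derive1n f n : flat_expr f -> flat_expr (f^`(n))%classic.
Proof.
move=> ef; elim: n => [//|n /flat_expr_is_derive[f' ef' df]]; rewrite derive1nS.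
suff -> : (f^`(n))^`()%classic = f' by [].
by apply/funext => x; rewrite derive1E; exact: (@derive_val _ _ _ _ _ _ _ (df x)).
Qed.

Lemma flat_expr_smooth f : flat_expr f -> smooth f.
Proof.
by move=> ef n x; have [f' _ df] := flat_expr_is_derive (flat_expr_derive1n n ef); exact: ex_derive.
Qed.

(** The usual partition f(x) / (f(x) + f(1 - x)) of a flat f, which goes from 0
    to 1 on [0, 1]; the denominator is written so that it is visibly a
    flat_expr. *)
Definition step : R -> R :=
  flat 0 * (fun x => ((flat 0 + (flat 0 \o (fun t => -1 * t + 1))) x)^-1).

Lemma step_den_gt0 x : 0 < flat 0 x + flat 0 (-1 * x + 1).
Proof.
have [x0|x0] := ltP 0 x.
  by rewrite ltr_pwDl ?flat_gt0 ?flat_ge0.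
rewrite ltr_wpDl ?flat_gt0 ?flat_ge0//; lra.
Qed.

Lemma flat_expr_step : flat_expr step.
Proof.
apply: flat_expr_mul; first exact: flat_expr_flat.
apply: flat_expr_inv => [x|]; first by rewrite gt_eqF//; exact: step_den_gt0.
by apply: flat_expr_add; [|apply: flat_expr_affine]; exact: flat_expr_flat.
Qed.

Lemma step_le0 x : x <= 0 -> step x = 0.
Proof. by move=> x0; rewrite /step !fctE flat_npos// mul0r. Qed.

Lemma step_ge1 x : 1 <= x -> step x = 1.
Proof.
move=> x1; rewrite /step !fctE [X in _ + X]flat_npos; last lra.
rewrite addr0 divff// gt_eqF// flat_gt0//; lra.
Qed.

Lemma step_ge0_le1 x : 0 <= step x <= 1.
Proof.
rewrite /step !fctE; apply/andP; split.
  by rewrite mulr_ge0 ?flat_ge0// invr_ge0 ltW ?step_den_gt0.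
by rewrite ler_pdivrMr ?step_den_gt0// mul1r lerDl flat_ge0.
Qed.

End smooth_step.

(** * Approximate identities at Lebesgue points *)

Section mollified_jump.
Context {R : realType}.
Local Notation mu := (@lebesgue_measure R).
Implicit Types (u g : R -> R) (x y z N C : R).

Lemma is_derive_step x : is_derive x 1 step (step^`()%classic x).
Proof.
by rewrite derive1E; apply: derivableP;
  exact: (@flat_expr_smooth R _ (@flat_expr_step R) 0%N).
Qed.

Lemma continuous_dstep : continuous (step^`()%classic : R -> R).
Proof.
move=> x; apply/differentiable_continuous/derivable1_diffP.
exact: (@flat_expr_smooth R _ (@flat_expr_step R) 1%N).
Qed.

Lemma dstep_eq0 x : ~~ (0 <= x <= 1) -> step^`()%classic x = 0.
Proof.
rewrite negb_and -!ltNge derive1E => /orP[x0|x1].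
- rewrite -(derive_cst (0:R) x (1:R)); apply: near_eq_derive; near=> y.
  by rewrite step_le0// ltW//; near: y; exact: lt_nbhsl.
- rewrite -(derive_cst (1:R) x (1:R)); apply: near_eq_derive; near=> y.
  by rewrite step_ge1// ltW//; near: y; exact: lt_nbhsr.
Unshelve. all: by end_near. Qed.

Lemma dstep_bounded : exists2 C : R, 0 <= C & forall x, `|step^`()%classic x| <= C.
Proof.
have [|c _ cP] := @EVT_max R (fun x => `|step^`()%classic x|) 0 1 ler01.
  apply: continuous_subspaceT => x.
  by apply: continuous_comp; [exact: continuous_dstep|exact: norm_continuous].
exists `|step^`()%classic c| => // x.
have [x01|/dstep_eq0 ->] := boolP (0 <= x <= 1); last by rewrite normr0.
by apply: cP; rewrite in_itv.
Qed.

(** N (z - x), written as an affine function of z. *)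
Definition dilate (N x z : R) := N * z + - (N * x).

Lemma is_derive_dilate N x z : is_derive z 1 (dilate N x) N.
Proof.
have h := is_deriveD (is_deriveZ N (is_derive_id z 1)) (is_derive_cst (- (N * x)) z 1).
by apply: (is_derive_eq h); rewrite addr0 [_ *: _]mulr1.
Qed.

(** An approximate identity: the derivative of the step of width 1/N starting
    at x, hence of mass 1 and supported in [x, x + 1/N]. *)
Definition mollifier N x z := step^`()%classic (dilate N x z) * N.

Lemma is_derive_dilated_step N x z : is_derive z 1 (step \o dilate N x) (mollifier N x z).
Proof. exact: (is_derive1_comp (is_derive_step _) (is_derive_dilate N x z)). Qed.

Lemma continuous_mollifier N x : continuous (mollifier N x).
Proof.
move=> z; apply: cvgM; last exact: cvg_cst.
apply: continuous_comp; last exact: continuous_dstep.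
apply/differentiable_continuous/derivable1_diffP.
exact: (@ex_derive _ _ _ _ _ _ _ (is_derive_dilate N x z)).
Qed.

Lemma mollifier_eq0 N x z : 0 < N -> z \notin `[x, x + N^-1] -> mollifier N x z = 0.
Proof.
move=> N0 zB; rewrite /mollifier dstep_eq0 ?mul0r//; apply: contra zB.
rewrite /dilate in_itv/= -mulrN -mulrDr pmulr_rge0// subr_ge0 => /andP[-> h].
by rewrite -lerBlDl -(ler_pM2l N0) divff ?gt_eqF.
Qed.

Lemma integral_mollifier N x : 0 < N ->
  (\int[mu]_(z in `[x, (x + N^-1)%R]) (mollifier N x z)%:E = 1)%E.
Proof.
move=> N0; rewrite (@continuous_FTC2 _ _ (step \o dilate N x)).
- have -> : (step \o dilate N x) x = 0 by rewrite /= /dilate subrr step_le0.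
  rewrite /= step_ge1 ?sube0// /dilate mulrDr divff ?gt_eqF//.
  by rewrite addrAC subrr add0r.
- by rewrite ltrDl invr_gt0.
- by apply: continuous_subspaceT => z; exact: continuous_mollifier.
- have c z : {for z, continuous (step \o dilate N x)}.
    apply/differentiable_continuous/derivable1_diffP.
    exact: (@ex_derive _ _ _ _ _ _ _ (is_derive_dilated_step N x z)).
  split => [z _||].
  + exact: (@ex_derive _ _ _ _ _ _ _ (is_derive_dilated_step N x z)).
  + by apply: cvg_at_right_filter; exact: c.
  + by apply: cvg_at_left_filter; exact: c.
- by move=> z _; rewrite derive1E (@derive_val _ _ _ _ _ _ _ (is_derive_dilated_step N x z)).
Qed.

Lemma integrable_mul_mollifier N x u (D : set R) : measurable D ->
  mu.-integrable setT (EFin \o u) ->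
  mu.-integrable D (EFin \o (fun z => u z * mollifier N x z)).
Proof.
move=> mD iu; have [C C0 hC] := dstep_bounded.
apply: (@integrableS _ _ _ _ setT) => //.
apply: (@integrableMl _ _ _ mu setT measurableT (EFin \o u) (mollifier N x)) => //.
  by apply: continuous_measurable_fun; exact: continuous_mollifier.
exists (C * `|N|); split; first exact: num_real.
move=> M CM z _ /=; apply/ltW/(le_lt_trans _ CM).
by rewrite normrM ler_wpM2r.
Qed.

(** The mollifier is at most C N on an interval inside the ball of radius 2/N,
    whose measure is 4/N: averaging against it costs a factor 4 C over the mean
    oscillation of u on that ball. *)
Lemma mollified_lebesgue_pt_le u x C N : 0 < N ->
  (forall t, `|step^`()%classic t : R| <= C) ->
  mu.-integrable setT (EFin \o u) ->
  (`| (\int[mu]_(z in `[x, x + N^-1]) (u z * mollifier N x z))%R%:E - (u x)%:E |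
    <= (4 * C)%:E * davg u x (2 / N))%E.
Proof.
move=> N0 hC iu.
set B := `[x, x + N^-1]%classic.
have C0 : 0 <= C by apply: le_trans (hC 0).
have mB : measurable B by exact: measurable_itv.
have mub : measurable_fun setT u by apply/measurable_EFinP; case/integrableP: iu.
have ib1 : mu.-integrable B (EFin \o mollifier N x).
  apply: continuous_compact_integrable; first exact: segment_compact.
  by apply: continuous_subspaceT => z; exact: continuous_mollifier.
have iub := @integrable_mul_mollifier N x u B mB iu.
have icb : mu.-integrable B (EFin \o (fun z => u x * mollifier N x z)).
  exact: (@integrableZl _ _ _ mu B mB (u x) (EFin \o mollifier N x) ib1).
have -> : u x = \int[mu]_(z in B) (u x * mollifier N x z).
  by rewrite RintegralZl// /Rintegral integral_mollifier//= mulr1.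
rewrite -EFinB -RintegralB// -[X in (X <= _)%E]/(`|_|%:E).
under eq_Rintegral do rewrite -mulrBl.
have idb : mu.-integrable B (EFin \o (fun z => (u z - u x) * mollifier N x z)).
  apply: (@eq_integrable _ _ _ mu B mB
      (fun z => (u z * mollifier N x z)%:E - (u x * mollifier N x z)%:E)%E) => [z _|].
    by rewrite /= -EFinB mulrBl.
  exact: integrableB.
rewrite EFin_normr_Rintegral//; apply: (le_trans (le_abse_integral _ _ _)) => //.
  by case/integrableP: idb.
have sB : B `<=` ball x (2 / N).
  move=> z; rewrite /B/= in_itv/= => /andP[xz zx].
  rewrite /ball/= ler0_norm ?subr_le0// opprB.
  have : 0 < N^-1 by rewrite invr_gt0.
  lra.
have mUd : measurable_fun setT (fun z : R => (`|u z - u x|)%:E).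
  apply/measurable_EFinP; apply: measurableT_comp => //.
  exact: measurable_funB.
apply: (@le_trans _ _ (\int[mu]_(z in B) ((N * C)%:E * (`|u z - u x|)%:E))%E).
  apply: ge0_le_integral => //=.
  - apply/measurable_EFinP; apply: measurableT_comp => //.
    by apply/measurable_EFinP; exact: (measurable_int mu idb).
  - by apply: measurable_funeM; exact: measurable_funTS.
  - move=> z _; rewrite lee_fin normrM mulrC ler_wpM2r// /mollifier normrM mulrC.
    by rewrite (gtr0_norm N0) ler_wpM2l// ltW.
rewrite ge0_integralZl//; last 2 first.
- exact: measurable_funTS.
- by rewrite lee_fin mulr_ge0// ltW.
rewrite /davg /iavg lebesgue_measure_ball; last by rewrite divr_ge0// ltW.
have p0 : 0 < 2 / N *+ 2 by rewrite mulrn_wgt0// divr_gt0.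
rewrite inver gt_eqF// muleA -EFinM.
have -> : 4 * C / (2 / N *+ 2) = N * C by field; lra.
apply: lee_wpmul2l; first by rewrite lee_fin mulr_ge0// ltW.
apply: ge0_subset_integral => //=; first exact: measurable_ball.
exact: measurable_funTS.
Qed.

(** At a Lebesgue point the mean oscillation tends to 0, so mollification
    recovers the value of u; integrating over the half-line loses nothing
    because the mollifiers live to the right of x > 0. *)
Lemma mollified_lebesgue_pt u x : 0 < x ->
  mu.-integrable setT (EFin \o u) -> lebesgue_pt u x ->
  \int[mu]_(z in `]0%R, +oo[) (u z * mollifier n.+1%:R x z) @[n --> \oo] --> u x.
Proof.
move=> x0 iu xu; have [C C0 hC] := dstep_bounded.
have -> : (fun n => \int[mu]_(z in `]0%R, +oo[) (u z * mollifier n.+1%:R x z)) =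
    (fun n => \int[mu]_(z in `[x, x + n.+1%:R^-1]) (u z * mollifier n.+1%:R x z)).
  apply/funext => n; rewrite Rintegral_mkcond [RHS]Rintegral_mkcond.
  apply: eq_Rintegral => z _; rewrite !patchE.
  case: ifPn => zU; case: ifPn => zB //.
  - rewrite mollifier_eq0 ?mulr0 ?ltr0n//.
    by apply: contra zB; rewrite inE.
  - move: zU zB; rewrite notin_setE inE/= !in_itv/= andbT => zU /andP[xz _].
    by case: zU; exact: lt_le_trans xz.
pose I n := \int[mu]_(z in `[x, x + n.+1%:R^-1]) (u z * mollifier n.+1%:R x z).
suff h : (I n)%:E @[n --> \oo] --> (u x)%:E by exact: (fine_cvg h).
apply: (sube_cvg0 _ _).1 => //=; apply/cvg_abse0P.
apply: (@squeeze_cvge _ _ _ _ (cst 0%E) _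
  (fun n => (4 * C)%:E * davg u x (2 / n.+1%:R))%E); last 2 first.
- exact: cvg_cst.
- move/cvge_at_rightP : xu => /(_ (fun n => 2 / n.+1%:R)) xu.
  rewrite -(mule0 (4 * C)%:E); apply: cvgeM => //; first exact: cvg_cst.
  apply: xu; split => [n|]; first by rewrite divr_gt0// ltr0n.
  rewrite -[X in _ --> X](mulr0 2); apply: cvgM; first exact: cvg_cst.
  exact: cvg_harmonic.
- apply: nearW => n /=; apply/andP; split => //.
  exact: mollified_lebesgue_pt_le.
Qed.
End mollified_jump.

(** * Increments of a function with a weak derivative *)

Section weak_derivative_increment.
Context {R : realType}.
Local Notation mu := (@lebesgue_measure R).
Implicit Types (u g : R -> R) (x y z N : R).

(** A smooth approximation of the indicator of ]x, y]. As a difference of two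
    steps (rather than a product) its derivative is exactly a difference of two
    mollifiers, however close x and y are. *)
Definition plateau N x y : R -> R :=
  (step \o dilate N x) + (cst (-1) * (step \o dilate N y)).

Lemma is_derive_plateau N x y z :
  is_derive z 1 (plateau N x y) (mollifier N x z - mollifier N y z).
Proof.
have h := is_deriveD (is_derive_dilated_step N x z)
  (is_deriveM (is_derive_cst (-1 : R) z (1 : R)) (is_derive_dilated_step N y z)).
by apply: (is_derive_eq h); rewrite !fctE /GRing.scale/= mulr0 addr0 mulN1r.
Qed.

Lemma smooth_plateau N x y : smooth (plateau N x y).
Proof.
apply: flat_expr_smooth; apply: flat_expr_add; first exact: (flat_expr_affine _ _ flat_expr_step).
by apply: flat_expr_mul; [exact: flat_expr_cst|exact: (flat_expr_affine _ _ flat_expr_step)].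
Qed.

Lemma step_dilate_le N x z : 0 < N -> z <= x -> step (dilate N x z) = 0.
Proof. by move=> N0 zx; rewrite step_le0// /dilate subr_le0 ler_pM2l. Qed.

Lemma step_dilate_ge N x z : 0 < N -> x + N^-1 <= z -> step (dilate N x z) = 1.
Proof.
move=> N0 xz; rewrite step_ge1// /dilate -mulrN -mulrDr.
by rewrite -ler_pdivrMl// mulr1 lerBrDl.
Qed.

Lemma plateau_eq0 N x y z : 1 <= N -> x <= y -> z \notin `[x, y + 1] ->
  plateau N x y z = 0.
Proof.
move=> N1 xy; have N0 : 0 < N by apply: lt_le_trans N1.
rewrite /plateau !fctE in_itv/= negb_and -!ltNge => /orP[zx|yz].
  by rewrite !step_dilate_le ?mulr0 ?addr0//; lra.
have : N^-1 <= 1 by rewrite invf_le1.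
by move=> V1; rewrite !step_dilate_ge ?mulr1 ?subrr//; lra.
Qed.

Lemma plateau_norm_le1 N x y z : `|plateau N x y z| <= 1.
Proof.
rewrite /plateau !fctE mulN1r ler_norml.
have /andP[? ?] := step_ge0_le1 (dilate N x z).
have /andP[? ?] := step_ge0_le1 (dilate N y z).
by apply/andP; split; lra.
Qed.

Lemma Cc_infty_plateau N x y : 0 < x -> x <= y -> 1 <= N ->
  Cc_infty `]0, +oo[ (plateau N x y).
Proof.
move=> x0 xy N1.
have sub : closure [set z | plateau N x y z != 0] `<=` `[x, y + 1].
  have /closure_id -> : closed `[x, y + 1]%classic by exact: interval_closed.
  by apply: closure_subset => z /=; apply: contraNT => /plateau_eq0 ->.
split; first exact: smooth_plateau.
- apply: (@subclosed_compact _ _ `[x, y + 1]%classic) => //.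
    exact: closed_closure.
  exact: segment_compact.
- move=> z /sub; rewrite /= !in_itv/= andbT => /andP[xz _].
  exact: lt_le_trans xz.
Qed.

Lemma cvg_step_dilate x z :
  step (dilate n.+1%:R x z) @[n --> \oo] --> ((x < z)%R%:R : R).
Proof.
have [zx|xz] := leP z x.
  apply: cvg_near_cst; apply: nearW => n.
  by rewrite step_dilate_le// ltr0n.
apply: cvg_near_cst; near=> n.
rewrite step_dilate_ge ?ltr0n// -lerBrDl; apply/ltW.
by near: n; apply: near_infty_natSinv_lt (PosNum _); rewrite subr_gt0.
Unshelve. all: by end_near. Qed.

Lemma cvg_plateau x y z : x <= y ->
  plateau n.+1%:R x y z @[n --> \oo] --> (\1_(`]x, y]%classic) z : R).
Proof.
move=> xy.
have -> : \1_(`]x, y]%classic) z = (x < z)%R%:R + -1 * (y < z)%R%:R :> R.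
  rewrite indicE mem_setE in_itv/= (leNgt z y) mulN1r.
  have [yz|] := ltP y z; last by rewrite subr0 andbT.
  by rewrite (le_lt_trans xy yz) subrr.
apply: cvgD; first exact: cvg_step_dilate.
by apply: cvgM; [exact: cvg_cst|exact: cvg_step_dilate].
Qed.

Lemma integrable_weak_derivative g (U K : set R) :
  locally_integrable U g -> compact K -> K `<=` U ->
  mu.-integrable K (EFin \o g).
Proof.
move=> [mg oU ig] cK KU; apply/integrableP; split; last exact: ig.
apply/measurable_EFinP; apply: measurable_funS mg => //.
exact: open_measurable.
Qed.

(** Fundamental theorem of calculus for a weak derivative. Testing against the
    plateaus: their derivatives recover u x - u y by the approximate identity
    property at Lebesgue points, while the plateaus themselves converge
    boundedly to the indicator of ]x, y]. *)
Lemma weak_derivative_increment u g x y :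
  is_weak_derivative `]0, +oo[ u g -> mu.-integrable setT (EFin \o u) ->
  0 < x -> x <= y -> lebesgue_pt u x -> lebesgue_pt u y ->
  u y - u x = \int[mu]_(z in `]x, y]) g z.
Proof.
move=> [_ lg wug] iu x0 xy xu yu.
pose U : set R := `]0, +oo[%classic; rewrite -/U in wug lg.
have mU : measurable U by exact: measurable_itv.
have /= y0 := lt_le_trans x0 xy.
have cu : \int[mu]_(z in U) (u z * (plateau n.+1%:R x y)^`()%classic z)
    @[n --> \oo] --> u x - u y.
  have -> : (fun n => \int[mu]_(z in U) (u z * (plateau n.+1%:R x y)^`()%classic z)) =
     (fun n => \int[mu]_(z in U) (u z * mollifier n.+1%:R x z) -
               \int[mu]_(z in U) (u z * mollifier n.+1%:R y z)).
    apply/funext => n; rewrite -RintegralB//; last 2 first.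
      exact: integrable_mul_mollifier.
      exact: integrable_mul_mollifier.
    apply: eq_Rintegral => z _; rewrite -mulrBr derive1E; congr (_ * _).
    exact: (@derive_val _ _ _ _ _ _ _ (is_derive_plateau n.+1%:R x y z)).
  by apply: cvgB; exact: mollified_lebesgue_pt.
set K := `[x, y + 1]%classic.
have KU : K `<=` U.
  move=> z; rewrite /K /U /= !in_itv/= andbT => /andP[xz _].
  exact: lt_le_trans xz.
have mK : measurable K by exact: measurable_itv.
have ig : mu.-integrable K (EFin \o g).
  by apply: (integrable_weak_derivative lg) => //; exact: segment_compact.
have mg : measurable_fun K g by apply/measurable_EFinP; exact: (measurable_int mu ig).
have cg : \int[mu]_(z in U) (g z * plateau n.+1%:R x y z)
    @[n --> \oo] --> \int[mu]_(z in `]x, y]) g z.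
  have -> : (fun n => \int[mu]_(z in U) (g z * plateau n.+1%:R x y z)) =
      (fun n => \int[mu]_(z in K) (g z * plateau n.+1%:R x y z)).
    apply/funext => n; rewrite Rintegral_mkcond [RHS]Rintegral_mkcond.
    apply: eq_Rintegral => z _; rewrite !patchE.
    case: ifPn => zU; case: ifPn => zK //.
    - rewrite plateau_eq0 ?mulr0 ?ler1n//.
      by apply: contra zK; rewrite inE.
    - by move: zU zK; rewrite notin_setE inE => zU /KU.
  have -> : \int[mu]_(z in `]x, y]) g z =
      \int[mu]_(z in K) (g z * \1_(`]x, y]%classic) z).
    rewrite Rintegral_mkcond [RHS]Rintegral_mkcond.
    apply: eq_Rintegral => z _; rewrite !patchE indicE.
    case: ifPn => zI; case: ifPn => zK; rewrite ?mulr1 ?mulr0//.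
    move: zI zK; rewrite inE notin_setE /K/= !in_itv/= => /andP[xz zy].
    by case; apply/andP; split; lra.
  have [||||| i1 _] := @dominated_convergence _ _ _ mu K mK
    (fun n z => (g z * plateau n.+1%:R x y z)%:E)
    (fun z => (g z * \1_(`]x, y]%classic) z)%:E) (fun z => `|(g z)%:E|%E).
  - move=> n; apply/measurable_EFinP; apply: measurable_funM => //.
    apply: measurable_funTS; apply: continuous_measurable_fun => z.
    apply/differentiable_continuous/derivable1_diffP.
    exact: (@ex_derive _ _ _ _ _ _ _ (is_derive_plateau _ x y z)).
  - by apply/measurable_EFinP; apply: measurable_funM.
  - apply: aeW => z _; apply: cvg_EFin; first exact: nearW.
    by apply: cvgM; [exact: cvg_cst|exact: cvg_plateau].
  - exact: integrable_abse.
  - apply: aeW => z n _; rewrite lee_fin normrM ler_piMr//.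
    exact: plateau_norm_le1.
  by move=> h; apply: fine_cvg; rewrite fineK//; exact: integrable_fin_num.
have cg' := cvgN cg.
have : u x - u y = - \int[mu]_(z in `]x, y]) g z.
  apply: (cvg_unique _ cu) => //.
  suff -> : (fun n => \int[mu]_(z in U) (u z * (plateau n.+1%:R x y)^`()%classic z)) =
      (fun n => - \int[mu]_(z in U) (g z * plateau n.+1%:R x y z)) by exact: cg'.
  apply/funext => n; apply: wug; apply: Cc_infty_plateau => //.
  by rewrite ler1n.
by move/(congr1 -%R); rewrite opprK opprB.
Qed.

End weak_derivative_increment.

(** * Translation invariance and Cauchy-Schwarz *)

Section general_integration.
Context {R : realType}.
Local Notation mu := (@lebesgue_measure R).

(** The translate of Lebesgue measure agrees with it on half-open intervals. *)
Lemma ge0_integral_translation (f : R -> \bar R) (a : R) :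
  measurable_fun setT f -> (forall x, 0 <= f x)%E ->
  (\int[mu]_y f y = \int[mu]_s f (a + s)%R)%E.
Proof.
move=> mf f0; pose phi : R -> measurableTypeR R := fun s => a + s.
have mphi : measurable_fun setT phi by exact: measurable_funD.
transitivity (\int[pushforward mu phi]_y f y)%E; last first.
  by rewrite ge0_integral_pushforward.
apply: eq_measure_integral => //= A mA _.
apply: (@lebesgue_measure_unique R (pushforward mu phi)) => //= _ [[c b]] _ <-.
rewrite /pushforward/= (_ : phi @^-1` _ = `]c - a, b - a]%classic).
  rewrite !lebesgue_measure_itv/= !lte_fin ltrD2r; case: ifPn => // _.
  by rewrite -!EFinB; congr EFin; ring.
apply/seteqP; split => x; rewrite /phi/= !in_itv/= => /andP[? ?];
  by apply/andP; split; lra.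
Qed.

(** Cauchy-Schwarz against the constant 1. When f^2 is integrable, it is obtained
    by integrating 2 m f - m^2 <= f^2 with m the mean of f; otherwise the
    right-hand side is infinite. *)
Lemma sqr_Rintegral_le (f : R -> R) (x y : R) : x <= y ->
  mu.-integrable `]x, y] (EFin \o f) ->
  (((\int[mu]_(z in `]x, y]) f z)%R ^+ 2)%:E
    <= (y - x)%:E * \int[mu]_(z in `]x, y]) (f z ^+ 2)%:E)%E.
Proof.
rewrite le_eqVlt => /predU1P[<- _|xy fi].
  by rewrite set_itvoc0 Rintegral_set0 integral_set0 expr0n mule0.
set I := `]x, y]%classic.
have mI : measurable I by exact: measurable_itv.
have mf : measurable_fun I f by apply/measurable_EFinP; exact: (measurable_int mu fi).
have mf2 : measurable_fun I (fun z => f z ^+ 2) by exact: measurable_funX.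
have muI : mu I = (y - x)%:E.
  by rewrite /I lebesgue_measure_itv/= lte_fin xy EFinB.
have L0 : 0 < y - x by rewrite subr_gt0.
have [fy|] := ltP (\int[mu]_(z in I) (f z ^+ 2)%:E)%E +oo%E; last first.
  by rewrite leye_eq => /eqP ->; rewrite gt0_muley ?leey.
have i2 : mu.-integrable I (EFin \o (fun z => f z ^+ 2)).
  apply/integrableP; split; first exact/measurable_EFinP.
  under eq_integral => z zI do rewrite gee0_abs ?lee_fin ?sqr_ge0//.
  by [].
set J := \int[mu]_(z in I) f z.
pose m := J / (y - x).
have ic (c : R) : mu.-integrable I (EFin \o cst c).
  apply: measurable_bounded_integrable => //.
    by rewrite /= muI ltry.
  exact: bounded_cst.
have im : mu.-integrable I (EFin \o (fun z => 2 * m * f z)).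
  exact: (@integrableZl _ _ _ mu I mI (2 * m) (EFin \o f) fi).
have h : \int[mu]_(z in I) (2 * m * f z - m ^+ 2) <= \int[mu]_(z in I) (f z ^+ 2).
  apply: le_Rintegral => //.
    exact: (@integrableB _ _ _ mu I mI _ (EFin \o cst (m ^+ 2)) im (ic _)).
  move=> z _; have := sqr_ge0 (f z - m); lra.
have -> : (\int[mu]_(z in I) (f z ^+ 2)%:E = (\int[mu]_(z in I) (f z ^+ 2))%R%:E)%E.
  by rewrite /Rintegral fineK//; exact: integrable_fin_num.
rewrite -EFinM lee_fin.
move: h; rewrite RintegralB//; last exact: ic.
rewrite RintegralZl// -/J Rintegral_cst//= muI/=.
have -> : J = m * (y - x) by rewrite /m divfK// gt_eqF.
set S := \int[mu]_(_ in _) _ => h.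
have -> : (m * (y - x)) ^+ 2 = (y - x) * (m ^+ 2 * (y - x)) by ring.
by rewrite ler_wpM2l ?(ltW L0)//; lra.
Qed.

Lemma integral_if_cst (P : R -> bool) (c : R) : measurable_fun setT P ->
  (\int[mu]_x (if P x then c else 0)%:E = c%:E * mu [set x | P x])%E.
Proof.
move=> mP; have mA : measurable [set x | P x].
  by rewrite -[X in measurable X]setTI; exact: (mP measurableT [set true]).
rewrite -(integral_cst mu mA) [RHS]integral_mkcond; apply: eq_integral => x _.
rewrite patchE; have [Px|Px] := boolP (P x); first by rewrite mem_set.
by rewrite memNset//=; exact/negP.
Qed.

End general_integration.

(** * Slices, the kernel and the weight *)

Section slices.
Context {R : realType}.
Local Notation mu := (@lebesgue_measure R).
Implicit Types (x y z s t : R).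

Definition between x y z := (x < z <= y) || (y < z <= x).

(** The positive starting points x of those segments from x to x + s with
    positive endpoints that cover z. *)
Definition segment_slice s z : set R :=
  [set x | [&& 0 < x, 0 < x + s & between x (x + s) z]].

(** For t > 0 the constraint |s| < z / t of the weight, cleared of the
    division. *)
Definition weight_slice s z : set R :=
  [set t | [&& 0 < t, t < 1 & `|s| * t < z]].

Lemma measurable_segment_slice s z : measurable (segment_slice s z).
Proof.
suff m : measurable_fun setT (fun x : R => [&& 0 < x, 0 < x + s & between x (x + s) z]).
  by rewrite -[X in measurable X]setTI; exact: (m measurableT [set true]).
have mid : measurable_fun setT (@id R) by [].
have mD : measurable_fun setT (fun x : R => x + s) by exact: measurable_funD.
by rewrite /between; repeat (apply: measurable_and || apply: measurable_or ||
   apply: measurable_fun_ltr || apply: measurable_fun_ler); try exact: measurable_cst.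
Qed.

Lemma measurable_weight_slice s z : measurable (weight_slice s z).
Proof.
suff m : measurable_fun setT (fun t : R => [&& 0 < t, t < 1 & `|s| * t < z]).
  by rewrite -[X in measurable X]setTI; exact: (m measurableT [set true]).
have mid : measurable_fun setT (@id R) by [].
have mM : measurable_fun setT (fun t : R => `|s| * t) by exact: measurable_funM.
by repeat (apply: measurable_and || apply: measurable_fun_ltr);
  try exact: measurable_cst.
Qed.

Lemma measure_segment_slice_le s z : 0 < z ->
  (mu (segment_slice s z) <= (Num.min `|s| z)%:E)%E.
Proof.
move=> z0; set m := Num.min `|s| z.
have m0 : 0 <= m by rewrite le_min normr_ge0 ltW.
(* The left endpoint a depends on the sign of s and on whether |s| <= z. *)
suff [a sub] : exists a, segment_slice s z `<=` `[a, a + m].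
  apply: (@le_trans _ _ (mu `[a, a + m])).
    apply: le_measure => //; rewrite inE; first exact: measurable_segment_slice.
    exact: measurable_itv.
  rewrite lebesgue_measure_itv/= lte_fin; case: ifPn => _; rewrite ?lee_fin//.
  lra.
rewrite /m; have [sz|zs] := leP `|s| z; have [s0|s0] := leP 0 s.
- exists (z - s) => x /=; rewrite ger0_norm// in_itv/= /between.
  by move=> /and3P[? ?] /orP[|] /andP[? ?]; apply/andP; split; lra.
- exists z => x /=; rewrite ltr0_norm// in_itv/= /between.
  by move=> /and3P[? ?] /orP[|] /andP[? ?]; apply/andP; split; lra.
- exists 0 => x /=; rewrite in_itv/= /between.
  by move=> /and3P[? ?] /orP[|] /andP[? ?]; apply/andP; split; lra.
- exists (- s) => x /=; rewrite in_itv/= /between.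
  by move=> /and3P[? ?] /orP[|] /andP[? ?]; apply/andP; split; lra.
Qed.

Lemma measure_weight_slice_ge s z : s != 0 -> 0 < z ->
  ((Num.min `|s| z / `|s|)%:E <= mu (weight_slice s z))%E.
Proof.
move=> s0 z0; have s_gt0 : 0 < `|s| by rewrite normr_gt0.
set m := Num.min `|s| z.
have m0 : 0 < m / `|s| by rewrite divr_gt0// lt_min s_gt0 z0.
have -> : ((m / `|s|)%:E = mu `]0%R, (m / `|s|)%R[)%E.
  by rewrite lebesgue_measure_itv/= lte_fin m0 sube0.
apply: le_measure; rewrite ?inE; first exact: measurable_itv.
  exact: measurable_weight_slice.
move=> t; rewrite /weight_slice/= in_itv/= ltr_pdivlMr// lt_min => /andP[-> /andP[ts tz]].
by rewrite mulrC tz andbT/= -(ltr_pM2r s_gt0) mul1r.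
Qed.

(** The geometric heart of the estimate: both sides are compared with
    |s| min(|s|, z). *)
Lemma slice_comparison s z : 0 < z ->
  (`|s|%:E * mu (segment_slice s z) <= (`|s| ^+ 2)%:E * mu (weight_slice s z))%E.
Proof.
move=> z0; have [->|s0] := eqVneq s 0.
  by rewrite normr0 mul0e expr0n mul0e.
have s_gt0 : 0 < `|s| by rewrite normr_gt0.
apply: (@le_trans _ _ (`|s|%:E * (Num.min `|s| z)%:E)%E).
  by apply: lee_wpmul2l => //; exact: measure_segment_slice_le.
apply: (@le_trans _ _ ((`|s| ^+ 2)%:E * (Num.min `|s| z / `|s|)%:E)%E).
  by rewrite -!EFinM lee_fin expr2 mulrACA divff ?gt_eqF// mulr1.
by apply: lee_wpmul2l; rewrite ?lee_fin ?sqr_ge0//; exact: measure_weight_slice_ge.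
Qed.

End slices.

Section kernel.
Context {R : realType}.
Local Notation mu := (@lebesgue_measure R).
Variables (gamma : R -> R) (delta : R).
Hypotheses (hgamma : kernel_profile gamma) (delta_gt0 : 0 < delta).
Local Notation k := (qnl_kernel gamma delta).

Lemma qnl_kernel_ge0 s : 0 <= k s.
Proof.
apply: mulr_ge0; first by rewrite invr_ge0 exprn_ge0// ltW.
by apply: (kernel_ge0 hgamma); rewrite divr_ge0// ltW.
Qed.

Lemma qnl_kernel_norm s : k `|s| = k s.
Proof. by rewrite /qnl_kernel normr_id. Qed.

(** The profile may blow up at 0, so it need not be the restriction of a
    real-valued monotone function on the line; its superlevel sets in ]0, 1[ are
    nevertheless intervals. *)
Lemma measurable_profile01 : measurable_fun (`]0, 1[%classic : set R) gamma.
Proof.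
apply: (measurability (@RGenCInfty.G R)) => [|/= _ [_] [r] -> <-].
  exact: RGenCInfty.measurableE.
apply: is_interval_measurable => s t/=.
rewrite !in_itv/= !andbT => -[/andP[s0 s1] rs] [/andP[t0 t1] rt] v /andP[sv vt].
split; first by rewrite in_itv/=; apply/andP; split; lra.
rewrite /= in_itv/= andbT.
by apply: (le_trans rt); apply: (kernel_nincr hgamma) => //; lra.
Qed.

Lemma measurable_qnl_kernel : measurable_fun setT k.
Proof.
pose G r := if r == 0 then gamma 0 else if r == 1 then gamma 1 else
  (gamma \_ `]0, 1[) r.
have mG : measurable_fun setT G.
  apply: measurable_fun_ifT; [exact: measurable_fun_eqr|exact: measurable_cst|].
  apply: measurable_fun_ifT; [exact: measurable_fun_eqr|exact: measurable_cst|].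
  exact: ((measurable_restrictT gamma (measurable_itv _)).1 measurable_profile01).
have -> : k = (fun s => delta ^- 3 * G (`|s| / delta)).
  apply/funext => s; rewrite /qnl_kernel; congr (_ * _).
  have : 0 <= `|s| / delta by rewrite divr_ge0// ltW.
  move: (`|s| / delta) => r r0; rewrite /G patchE.
  have [->//|rn0] := eqVneq r 0; have [->//|rn1] := eqVneq r 1.
  case: ifPn => //; rewrite notin_setE/= in_itv/= => /negP.
  rewrite lt_neqAle eq_sym rn0 r0/= -leNgt => r1.
  by apply: (kernel_supp hgamma); rewrite lt_neqAle eq_sym rn1.
apply: measurable_funM; first exact: measurable_cst.
apply: (measurableT_comp mG); apply: measurable_funM; last exact: measurable_cst.
exact: normr_measurable.
Qed.

(** The integrand of the weight in the variables q = ((z, s), t), made jointly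
    measurable so that Tonelli's theorem applies. *)
Definition weight_density (q : (R * R) * R) : \bar R :=
  (if [&& 0 < q.2, q.2 < 1 & `|q.1.2| * q.2 < q.1.1]
   then `|q.1.2| ^+ 2 * k q.1.2 else 0)%:E.

Lemma weight_density_ge0 q : (0 <= weight_density q)%E.
Proof.
rewrite lee_fin; case: ifP => // _.
by rewrite mulr_ge0 ?qnl_kernel_ge0 ?exprn_ge0.
Qed.

Lemma measurable_weight_density : measurable_fun setT weight_density.
Proof.
have mz : measurable_fun setT (fun q : (R * R) * R => q.1.1).
  by apply: measurableT_comp => //; exact: measurable_fst.
have mk : measurable_fun setT (fun q : (R * R) * R => q.1.2).
  by apply: measurableT_comp => //; exact: measurable_snd.
have ms : measurable_fun setT (fun q : (R * R) * R => `|q.1.2|).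
  by apply: measurableT_comp => //; exact: normr_measurable.
have mt : measurable_fun setT (fun q : (R * R) * R => q.2) by exact: measurable_snd.
apply/measurable_EFinP; apply: measurable_fun_ifT; last exact: measurable_cst.
  by repeat (apply: measurable_and || apply: measurable_fun_ltr);
    try exact: measurable_cst; try exact: measurable_funM.
apply: measurable_funM; first exact: measurable_funX.
by apply: measurableT_comp => //; exact: measurable_qnl_kernel.
Qed.

Lemma integral_weight_density z s :
  (\int[mu]_t weight_density ((z, s), t) =
   (`|s| ^+ 2 * k s)%:E * mu (weight_slice s z))%E.
Proof.
rewrite -integral_if_cst//.
have mM : measurable_fun setT (fun t : R => `|s| * t) by exact: measurable_funM.
by repeat (apply: measurable_and || apply: measurable_fun_ltr);
  try exact: measurable_cst.
Qed.

(** Tonelli: integrating in t first leaves the measure of the slice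
    weight_slice s z. *)
Lemma qnl_weightE z :
  (qnl_weight gamma delta z = \int[mu]_s \int[mu]_t weight_density ((z, s), t))%E.
Proof.
have mW : measurable_fun setT (fun p : R * R => weight_density ((z, p.2), p.1)).
  apply: (measurableT_comp measurable_weight_density).
  apply: measurable_fun_pair; last exact: measurable_fst.
  by apply: measurable_fun_pair; [exact: measurable_cst|exact: measurable_snd].
transitivity (\int[mu]_t \int[mu]_s weight_density ((z, s), t))%E; last first.
  have h := @fubini_tonelli _ _ _ _ _ mu mu _ mW (fun p => weight_density_ge0 _).
  exact: h.
rewrite /qnl_weight integral_mkcond; apply: eq_integral => t _; rewrite patchE.
case: ifPn => [|tn].
  rewrite inE/= in_itv/= => /andP[t0 t1].
  rewrite integral_mkcond; apply: eq_integral => s _.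
  rewrite patchE /weight_density/= t0 t1/= -ltr_pdivlMr//.
  have [h|h] := ltP `|s| (z / t); first by rewrite mem_set.
  by rewrite memNset//=; apply/negP; rewrite -leNgt.
rewrite integral0_eq// => s _; rewrite /weight_density/=.
case: ifPn => // /and3P[t0 t1 _].
by move: tn; rewrite notin_setE/= in_itv/= t0 t1.
Qed.

Lemma measurable_integral_weight_density :
  measurable_fun setT (fun p : R * R => \int[mu]_t weight_density (p, t))%E.
Proof.
have := @measurable_fun_fubini_tonelli_F _ _ _ _ _ mu _ measurable_weight_density
  weight_density_ge0.
exact.
Qed.

Lemma measurable_qnl_weight : measurable_fun setT (qnl_weight gamma delta).
Proof.
rewrite (_ : qnl_weight gamma delta = fun z =>
  \int[mu]_s \int[mu]_t weight_density ((z, s), t))%E; last first.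
  by apply/funext => z; exact: qnl_weightE.
have W0 (p : R * R) : (0 <= \int[mu]_t weight_density (p, t))%E.
  by apply: integral_ge0 => t _; exact: weight_density_ge0.
have := @measurable_fun_fubini_tonelli_F _ _ _ _ _ mu _
  measurable_integral_weight_density W0.
exact.
Qed.

End kernel.

(** * The weighted Dirichlet energy *)

Section comparison.
Context {R : realType}.
Local Notation mu := (@lebesgue_measure R).

(** On a set of finite measure L^2 is contained in L^1, by |u| <= 1 + u^2. *)
Lemma L2_zero_extension (D : set R) (u : R -> R) : measurable D ->
  (mu D < +oo)%E -> (forall x, ~ D x -> u x = 0) -> L2 D u ->
  measurable_fun setT u /\ mu.-integrable setT (EFin \o u).
Proof.
move=> mD muD u0 [mu_u u2].
have uD : u = u \_ D.
  apply/funext => x; rewrite patchE; case: ifPn => //.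
  by rewrite notin_setE => /u0.
split; first by rewrite uD; exact: (measurable_restrictT u mD).1 mu_u.
have i1 : mu.-integrable D (cst (1%E : \bar R)).
  apply/integrableP; split; first exact: measurable_cst.
  under eq_integral do rewrite /= normr1.
  by rewrite integral_cst// mul1e.
have i2 : mu.-integrable D (fun x => (`|u x| ^+ 2)%:E).
  apply/integrableP; split.
    apply/measurable_EFinP; apply: measurable_funX.
    by apply: measurableT_comp => //; exact: normr_measurable.
  by under eq_integral do rewrite gee0_abs ?lee_fin ?sqr_ge0//.
rewrite uD -restrict_EFin; apply/integrable_restrict => //; rewrite setTI.
apply: (@le_integrable _ _ _ mu D mD (EFin \o u)
  (fun x => 1 + (`|u x| ^+ 2)%:E)%E) => [||]; last exact: integrableD.
  exact/measurable_EFinP.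
move=> x _; rewrite /= lee_fin.
rewrite [X in _ <= X]ger0_norm ?addr_ge0 ?sqr_ge0//.
have := sqr_ge0 (`|u x| - 1); have := normr_ge0 (u x); lra.
Qed.

(** The increment is the integral of g over the segment, to which
    Cauchy-Schwarz applies; symmetric in x and y. *)
Lemma sqr_increment_le (u g : R -> R) (x y : R) :
  is_weak_derivative `]0, +oo[ u g -> mu.-integrable setT (EFin \o u) ->
  0 < x -> 0 < y -> lebesgue_pt u x -> lebesgue_pt u y ->
  (((u y - u x) ^+ 2)%:E <= `|y - x|%:E *
    \int[mu]_z (if between x y z then g z ^+ 2 else 0)%:E)%E.
Proof.
move=> wug iu.
wlog xy : x y / x <= y => [h|] x0 y0 xu yu.
  have [xy|/ltW yx] := leP x y; first exact: h.
  have -> : (u y - u x) ^+ 2 = (u x - u y) ^+ 2 by rewrite -sqrrN opprB.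
  rewrite distrC; under eq_integral do rewrite /between orbC.
  exact: h.
have ig : mu.-integrable `]x, y] (EFin \o g).
  case: wug => _ lg _.
  apply: (@integrableS _ _ _ mu (`[x, y]%classic : set R) (`]x, y]%classic : set R)) => //.
    by apply: subset_itvr; rewrite bnd_simp.
  apply: (integrable_weak_derivative lg); first exact: segment_compact.
  by move=> z; rewrite /= !in_itv/= andbT => /andP[/(lt_le_trans x0)].
rewrite (weak_derivative_increment wug iu x0 xy xu yu).
apply: (le_trans (sqr_Rintegral_le xy ig)).
rewrite ger0_norm ?subr_ge0// integral_mkcond.
rewrite le_eqVlt; apply/orP; left; apply/eqP; congr (_ * _)%E.
apply: eq_integral => z _; rewrite patchE.
have -> : (z \in `]x, y]%classic) = between x y z.
  rewrite mem_setE in_itv/= /between orbC; case: (boolP (y < z <= x)) => //.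
  by move=> /andP[yz zx]; move: (le_lt_trans xy yz); rewrite ltNge zx.
by case: ifP.
Qed.

Variables (gamma : R -> R) (delta : R).
Hypotheses (hgamma : kernel_profile gamma) (delta_gt0 : 0 < delta).
Local Notation k := (qnl_kernel gamma delta).
Implicit Types (g : R -> R) (s z : R).


(** In the variables q = ((x, s), z), what the point z contributes to the bound
    on the nonlocal energy of the pair (x, x + s). *)
Definition energy_density (g : R -> R) (q : (R * R) * R) : \bar R :=
  (if [&& 0 < q.1.1, 0 < q.1.1 + q.1.2 & between q.1.1 (q.1.1 + q.1.2) q.2]
   then k q.1.2 * `|q.1.2| * g q.2 ^+ 2 else 0)%:E.

Lemma energy_density_ge0 g q : (0 <= energy_density g q)%E.
Proof.
rewrite lee_fin; case: ifP => // _.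
rewrite mulr_ge0 ?sqr_ge0// mulr_ge0//.
exact: (qnl_kernel_ge0 hgamma delta_gt0).
Qed.

Lemma measurable_energy_density g : measurable_fun setT g ->
  measurable_fun setT (energy_density g).
Proof.
move=> mg.
have mx : measurable_fun setT (fun q : (R * R) * R => q.1.1).
  by apply: measurableT_comp => //; exact: measurable_fst.
have ms : measurable_fun setT (fun q : (R * R) * R => q.1.2).
  by apply: measurableT_comp => //; exact: measurable_snd.
have mz : measurable_fun setT (fun q : (R * R) * R => q.2) by exact: measurable_snd.
have my : measurable_fun setT (fun q : (R * R) * R => q.1.1 + q.1.2).
  exact: measurable_funD.
apply/measurable_EFinP; apply: measurable_fun_ifT; last exact: measurable_cst.
  by rewrite /between; repeat (apply: measurable_and || apply: measurable_or ||
   apply: measurable_fun_ltr || apply: measurable_fun_ler); try exact: measurable_cst.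
apply: measurable_funM; last first.
  by apply: measurable_funX; exact: (measurableT_comp mg mz).
apply: measurable_funM.
  by apply: measurableT_comp ms => //; exact: (measurable_qnl_kernel hgamma).
by apply: measurableT_comp ms => //; exact: normr_measurable.
Qed.

Lemma integral_energy_density_slice g s z :
  (\int[mu]_x energy_density g ((x, s), z) =
   (k s * `|s| * g z ^+ 2)%:E * mu (segment_slice s z))%E.
Proof.
rewrite -integral_if_cst//.
have mid : measurable_fun setT (@id R) by [].
have mD : measurable_fun setT (fun x : R => x + s) by exact: measurable_funD.
by rewrite /between; repeat (apply: measurable_and || apply: measurable_or ||
   apply: measurable_fun_ltr || apply: measurable_fun_ler); try exact: measurable_cst.
Qed.

(** Integrating in x leaves the measure of segment_slice s z, to be compared with
    the slice that appears in the weight. *)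
Lemma energy_density_slice_le g s z : 0 < z ->
  (\int[mu]_x energy_density g ((x, s), z) <=
   (g z ^+ 2)%:E * \int[mu]_t weight_density gamma delta ((z, s), t))%E.
Proof.
move=> z0; rewrite integral_energy_density_slice integral_weight_density.
have -> : ((k s * `|s| * g z ^+ 2)%:E * mu (segment_slice s z) =
    (g z ^+ 2 * k s)%:E * (`|s|%:E * mu (segment_slice s z)))%E.
  by rewrite muleA -EFinM; congr (_%:E * _)%E; ring.
have -> : ((g z ^+ 2)%:E * ((`|s| ^+ 2 * k s)%:E * mu (weight_slice s z)) =
    (g z ^+ 2 * k s)%:E * ((`|s| ^+ 2)%:E * mu (weight_slice s z)))%E.
  by rewrite !muleA -!EFinM; congr (_%:E * _)%E; ring.
apply: lee_wpmul2l; last exact: slice_comparison.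
rewrite lee_fin mulr_ge0 ?sqr_ge0//.
exact: (qnl_kernel_ge0 hgamma delta_gt0).
Qed.

(** Tonelli brings z outside, where the remaining integrals over x and s are
    bounded by g(z)^2 times the weight at z. *)
Lemma integral_energy_density_le g : measurable_fun setT g ->
  (forall z, z <= 0 -> g z = 0) ->
  (\int[mu]_x \int[mu]_s \int[mu]_z energy_density g ((x, s), z)
   <= \int[mu]_(z in `]0%R, +oo[) ((g z * g z)%:E * qnl_weight gamma delta z))%E.
Proof.
move=> mg g0.
have mH := measurable_energy_density mg; have H0 := energy_density_ge0 g.
have mHc (x s z : R * R * R -> R) : measurable_fun setT x -> measurable_fun setT s ->
    measurable_fun setT z ->
    measurable_fun setT (fun q => energy_density g ((x q, s q), z q)).
  move=> mx ms mz; apply: (measurableT_comp mH).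
  by apply: measurable_fun_pair => //; exact: measurable_fun_pair.
have m11 : measurable_fun setT (fun q : R * R * R => q.1.1).
  by apply: measurableT_comp => //; exact: measurable_fst.
have m12 : measurable_fun setT (fun q : R * R * R => q.1.2).
  by apply: measurableT_comp => //; exact: measurable_snd.
have m2 : measurable_fun setT (fun q : R * R * R => q.2) by exact: measurable_snd.
have mHx x : measurable_fun setT (fun p : R * R => energy_density g ((x, p.1), p.2)).
  apply: (measurableT_comp mH); apply: measurable_fun_pair; last exact: measurable_snd.
  by apply: measurable_fun_pair; [exact: measurable_cst|exact: measurable_fst].
have mHz z : measurable_fun setT (fun p : R * R => energy_density g (p, z)).
  exact: measurable_fun_pair1.
have mHs : measurable_fun setT
    (fun p : R * R => \int[mu]_s energy_density g ((p.1, s), p.2))%E.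
  have := @measurable_fun_fubini_tonelli_F _ _ _ _ _ mu _
    (mHc _ _ _ m11 m2 m12) (fun q => H0 _).
  exact.
have -> : (\int[mu]_x \int[mu]_s \int[mu]_z energy_density g ((x, s), z) =
    \int[mu]_z \int[mu]_s \int[mu]_x energy_density g ((x, s), z))%E.
  (* Exchange s with z, then x with z, then x with s. *)
  transitivity (\int[mu]_x \int[mu]_z \int[mu]_s energy_density g ((x, s), z))%E.
    apply: eq_integral => x _.
    have := @fubini_tonelli _ _ _ _ _ mu mu _ (mHx x) (fun p => H0 _).
    exact.
  transitivity (\int[mu]_z \int[mu]_x \int[mu]_s energy_density g ((x, s), z))%E.
    have := @fubini_tonelli _ _ _ _ _ mu mu _ mHs
      (fun p => integral_ge0 mu (fun s _ => H0 _)).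
    exact.
  apply: eq_integral => z _.
  have := @fubini_tonelli _ _ _ _ _ mu mu _ (mHz z) (fun p => H0 _).
  exact.
rewrite [leRHS]integral_mkcond.
have mG : measurable_fun setT
    (fun z => \int[mu]_s \int[mu]_x energy_density g ((x, s), z))%E.
  have mG' : measurable_fun setT
      (fun p : R * R => \int[mu]_x energy_density g ((x, p.2), p.1))%E.
    have := @measurable_fun_fubini_tonelli_F _ _ _ _ _ mu _
      (mHc _ _ _ m2 m12 m11) (fun q => H0 _).
    exact.
  have := @measurable_fun_fubini_tonelli_F _ _ _ _ _ mu _ mG'
    (fun p => integral_ge0 mu (fun x _ => H0 _)).
  exact.
apply: ge0_le_integral => //.
- by move=> z _; apply: integral_ge0 => s _; apply: integral_ge0 => x _; exact: H0.
- apply/(measurable_restrictT _ (measurable_itv _)); apply: measurable_funTS.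
  apply: emeasurable_funM; last exact: measurable_qnl_weight.
  by apply/measurable_EFinP; exact: measurable_funM.
move=> z _; rewrite patchE.
case: ifPn => [|zn].
  rewrite inE/= in_itv/= andbT => z0; rewrite (qnl_weightE hgamma delta_gt0) -ge0_integralZl//.
  - apply: ge0_le_integral => //.
    + by move=> s _; apply: integral_ge0 => x _; exact: H0.
    + have := @measurable_fun_fubini_tonelli_G _ _ _ _ _ mu _ (mHz z) (fun p => H0 _).
      exact.
    + apply: measurable_funeM.
      apply: (measurableT_comp (measurable_integral_weight_density hgamma delta_gt0)).
      by apply: measurable_fun_pair; [exact: measurable_cst|].
    + by move=> s _; exact: energy_density_slice_le.
  - apply: (measurableT_comp (measurable_integral_weight_density hgamma delta_gt0)).
    by apply: measurable_fun_pair; [exact: measurable_cst|].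
  - move=> s _; apply: integral_ge0 => t _; exact: (weight_density_ge0 hgamma delta_gt0).
  - by rewrite lee_fin -expr2 sqr_ge0.
rewrite integral0_eq// => s _; rewrite integral_energy_density_slice g0.
  by rewrite expr0n mulr0 mul0e.
by rewrite leNgt; apply: contra zn => z0; rewrite inE/= in_itv/= z0.
Qed.

End comparison.

(** * The positive quadrant *)

Section positive_quadrant.
Context {R : realType}.
Local Notation mu := (@lebesgue_measure R).
Variables (gamma : R -> R) (delta : R).
Hypotheses (hgamma : kernel_profile gamma) (delta_gt0 : 0 < delta).
Local Notation k := (qnl_kernel gamma delta).
Implicit Types (u g : R -> R) (x y z s : R).

Lemma measurable_nonlocal_density u : measurable_fun setT u ->
  measurable_fun setT (fun p : R * R => (k `|p.2 - p.1| * (u p.2 - u p.1) ^+ 2)%:E).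
Proof.
move=> mu_u; apply/measurable_EFinP; apply: measurable_funM.
  apply: (measurableT_comp (measurable_qnl_kernel hgamma delta_gt0)).
  apply: measurableT_comp; first exact: normr_measurable.
  by apply: measurable_funB; [exact: measurable_snd|exact: measurable_fst].
by apply: measurable_funX; apply: measurable_funB; exact: measurableT_comp.
Qed.

Lemma nonlocal_density_ge0 u (p : R * R) :
  (0 <= (k `|p.2 - p.1| * (u p.2 - u p.1) ^+ 2)%:E)%E.
Proof.
rewrite lee_fin mulr_ge0 ?sqr_ge0//.
exact: (qnl_kernel_ge0 hgamma delta_gt0).
Qed.

(** The pointwise bound of the increments, rewritten as the integral over z of
    the joint density at s = y - x. *)
Lemma nonlocal_density_le_integral u g x y :
  is_weak_derivative `]0, +oo[ u g -> mu.-integrable setT (EFin \o u) ->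
  measurable_fun setT g ->
  0 < x -> 0 < y -> lebesgue_pt u x -> lebesgue_pt u y ->
  ((k `|y - x| * (u y - u x) ^+ 2)%:E <=
    \int[mu]_z energy_density gamma delta g ((x, (y - x)%R), z))%E.
Proof.
move=> wug iu mg x0 y0 xu yu.
have mid : measurable_fun setT (@id R) by [].
have mb : measurable_fun setT (between x y).
  by rewrite /between; repeat (apply: measurable_and || apply: measurable_or ||
   apply: measurable_fun_ltr || apply: measurable_fun_ler); try exact: measurable_cst.
have -> : (\int[mu]_z energy_density gamma delta g ((x, (y - x)%R), z) =
   (k (y - x))%:E * (`|y - x|%:E * \int[mu]_z (if between x y z then g z ^+ 2 else 0)%:E))%E.
  rewrite muleA -EFinM -ge0_integralZl//.
  - apply: eq_integral => z _; rewrite /energy_density/= x0/= addrC subrK y0/=.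
    by rewrite -EFinM; case: ifP => // _; rewrite mulr0.
  - apply/measurable_EFinP; apply: measurable_fun_ifT => //.
    exact: measurable_funX.
  - by move=> z _; rewrite lee_fin; case: ifP => // _; rewrite sqr_ge0.
  - by rewrite lee_fin mulr_ge0//; exact: (qnl_kernel_ge0 hgamma delta_gt0).
rewrite qnl_kernel_norm EFinM; apply: lee_wpmul2l.
  by rewrite lee_fin; exact: (qnl_kernel_ge0 hgamma delta_gt0).
exact: sqr_increment_le.
Qed.

(** Extending a weak derivative by zero gives a function measurable on the
    whole line, as Tonelli's theorem on the plane requires. *)
Lemma is_weak_derivative_restrict (U : set R) u g :
  is_weak_derivative U u g -> is_weak_derivative U u (g \_ U).
Proof.
move=> [lu [mg oU ig] wug].
have gU z : U z -> (g \_ U) z = g z by move=> Uz; rewrite patchE mem_set.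
split => //.
  split => //.
    apply: eq_measurable_fun mg => z; rewrite inE => Uz; exact/esym/gU.
  move=> K KU cK; rewrite (_ : \int[mu]_(x in K) _ = \int[mu]_(x in K) `|g x|%:E)%E.
    exact: ig.
  by apply: eq_integral => z; rewrite inE => /KU /gU ->.
move=> phi cphi; rewrite wug//; congr (- _); apply: eq_Rintegral => z.
by rewrite inE => /gU ->.
Qed.

(** On the quadrant x, y > 0 the nonlocal energy is at most the weighted Dirichlet
    energy: almost every x and almost every y is a Lebesgue point, where the
    pointwise bound holds, and the translation y = x + s puts the bound in the
    form treated above. *)
Lemma positive_quadrant_le u g :
  is_weak_derivative `]0, +oo[ u g -> measurable_fun setT u ->
  mu.-integrable setT (EFin \o u) ->
  (\int[mu \x mu]_(p in [set p : R * R | (0 < p.1)%R /\ (0 < p.2)%R])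
      (k `|(p.2 - p.1)%R| * (u p.2 - u p.1) ^+ 2)%:E
   <= \int[mu]_(z in `]0%R, +oo[) ((g z * g z)%:E * qnl_weight gamma delta z))%E.
Proof.
move=> wug mu_u iu.
pose U : set R := `]0, +oo[%classic.
have mU : measurable U by exact: measurable_itv.
pose h := g \_ U.
have wuh : is_weak_derivative U u h by exact: is_weak_derivative_restrict.
have mh : measurable_fun setT h.
  by apply/(measurable_restrictT _ mU); case: wug => _ [].
have -> : (\int[mu]_(z in U) ((g z * g z)%:E * qnl_weight gamma delta z) =
    \int[mu]_(z in U) ((h z * h z)%:E * qnl_weight gamma delta z))%E.
  by apply: eq_integral => z zU; rewrite /h patchE zU.
have h0 z : z <= 0 -> h z = 0.
  move=> z0; rewrite /h patchE memNset// /U/= in_itv/= andbT.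
  by apply/negP; rewrite -leNgt.
apply: le_trans (integral_energy_density_le hgamma delta_gt0 mh h0).
have mH := measurable_energy_density hgamma delta_gt0 mh.
have H0 := energy_density_ge0 hgamma delta_gt0 h.
pose Q : set (R * R) := [set p | (0 < p.1)%R /\ (0 < p.2)%R].
pose f (p : R * R) := (k `|p.2 - p.1| * (u p.2 - u p.1) ^+ 2)%:E.
pose F (p : R * R) := (\int[mu]_z energy_density gamma delta h (p, z))%E.
have mF : measurable_fun setT F.
  have := @measurable_fun_fubini_tonelli_F _ _ _ _ _ mu _ mH H0.
  exact.
have F0 p : (0 <= F p)%E by apply: integral_ge0 => z _; exact: H0.
pose S (p : R * R) : R * R := (p.1, p.2 - p.1).
have mS : measurable_fun setT S.
  apply: measurable_fun_pair; first exact: measurable_fst.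
  by apply: measurable_funB; [exact: measurable_snd|exact: measurable_fst].
have mFS : measurable_fun setT (F \o S) by exact: measurableT_comp.
have mQ : measurable Q.
  suff mb : measurable_fun setT (fun p : R * R => (0 < p.1) && (0 < p.2)).
    rewrite (_ : Q = [set: R * R] `&` (fun p => (0 < p.1) && (0 < p.2)) @^-1` [set true]).
      exact: mb.
    by rewrite setTI; apply/seteqP; split => p /= /andP.
  by apply: measurable_and; apply: measurable_fun_ltr => //; exact: measurable_cst.
have mf : measurable_fun setT (f \_ Q).
  apply/(measurable_restrictT _ mQ); apply: measurable_funTS.
  exact: measurable_nonlocal_density.
have f0 p : (0 <= (f \_ Q) p)%E.
  by rewrite patchE; case: ifP => // _; exact: nonlocal_density_ge0.
rewrite integral_mkcond -/f -/Q.
have -> : (\int[mu \x mu]_p (f \_ Q) p = \int[mu]_x \int[mu]_y (f \_ Q) (x, y))%E.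
  have := @fubini_tonelli1 _ _ _ _ _ mu mu _ mf f0.
  exact.
(* Undo the change of variables s = y - x. *)
have -> : (\int[mu]_x \int[mu]_s F (x, s) = \int[mu]_x \int[mu]_y (F \o S) (x, y))%E.
  apply: eq_integral => x _; apply/esym.
  have mFx : measurable_fun setT (fun y => (F \o S) (x, y)).
    exact: measurable_fun_pair2.
  have Fx0 y : (0 <= (F \o S) (x, y))%E by exact: F0.
  rewrite (ge0_integral_translation x mFx Fx0).
  by apply: eq_integral => s _; rewrite /S/= addrC addKr.
have lu : locally_integrable setT u by apply: open_integrable_locally => //; exact: openT.
have leb := lebesgue_differentiation lu.
have mfF := @measurable_fun_fubini_tonelli_F _ _ _ _ _ mu _ mf f0.
have mFSF := @measurable_fun_fubini_tonelli_F _ _ _ _ _ mu _ mFS (fun p => F0 _).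
apply: ae_ge0_le_integral => //.
- by move=> x _; apply: integral_ge0.
- by move=> x _; apply: integral_ge0 => y _; exact: F0.
move: (leb); apply: filterS; first exact: (ae_filter_ringOfSetsType mu).
move=> x xu _.
apply: ae_ge0_le_integral => //.
- exact: measurable_fun_pair2.
- by move=> y _; exact: F0.
- exact: measurable_fun_pair2.
move: (leb); apply: filterS; first exact: (ae_filter_ringOfSetsType mu).
move=> y yu _.
rewrite patchE; case: ifPn => [|_]; last exact: F0.
rewrite inE => -[/= x0 y0].
exact: nonlocal_density_le_integral.
Qed.

End positive_quadrant.

(** * The energy space *)

Section energy_space.
Context {R : realType}.
Local Notation mu := (@lebesgue_measure R).

Lemma measurable_qnl_domain (delta : R) : measurable (qnl_domain delta).
Proof.
apply: measurableU; first exact: measurable_itv.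
by apply: measurableU; [exact: measurable_itv|exact: measurable_set1].
Qed.

Lemma qnl_domain_ltey (delta : R) : 0 < delta -> (mu (qnl_domain delta) < +oo)%E.
Proof.
move=> d0; apply: (@le_lt_trans _ _ (mu `[- 1 - delta, 1])).
  apply: le_measure; rewrite ?inE; [exact: measurable_qnl_domain|exact: measurable_itv|].
  move=> x [|[|]]; rewrite /Omega/= ?in_itv/=.
  - by move=> /andP[? ?]; apply/andP; split; lra.
  - by move=> /andP[? ?]; apply/andP; split; lra.
  - by move=> ->; apply/andP; split; lra.
by rewrite lebesgue_measure_itv/=; case: ifP => _; rewrite -?EFinB ltry.
Qed.

End energy_space.

Theorem proposition3p1 (R : realType) (gamma : R -> R) (delta : R)
    (hgamma : kernel_profile gamma) (hdelta : 0 < delta < 1)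
    (u : R -> R) (hu : qnl_space gamma delta u) :
  (bqnl gamma delta u u >=
   \int[@lebesgue_measure R \x @lebesgue_measure R]_p
     (qnl_kernel gamma delta `|(p.2 - p.1)%R| * (u p.2 - u p.1) ^+ 2)%:E)%E.
Proof.
have delta0 : 0 < delta by case/andP: hdelta.
have [u0 uL2 wdu _] := hu.
have [mu_u iu] := L2_zero_extension (measurable_qnl_domain delta)
  (qnl_domain_ltey delta0) u0 uL2.
have wu : is_weak_derivative `]0, +oo[ u (weak_derivative `]0, +oo[ u).
  by case: wdu => g wug; exact: (xgetPex _ (ex_intro _ g wug)).
have quad := positive_quadrant_le hgamma delta0 wu mu_u iu.
pose A : set (R * R) := [set p | (p.1 <= 0)%R \/ (p.2 <= 0)%R].
pose Q : set (R * R) := [set p | (0 < p.1)%R /\ (0 < p.2)%R].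
have AQ : [set: R * R] = A `|` Q.
  apply/esym/seteqP; split => // p _; rewrite /A /Q/=.
  have [?|?] := leP p.1 0; first by left; left.
  by have [?|?] := leP p.2 0; [left; right|right].
have mQ : measurable Q.
  rewrite (_ : Q = `]0%R, +oo[%classic `*` `]0%R, +oo[%classic).
    by apply: measurableX; exact: measurable_itv.
  by apply/seteqP; split => p /=; rewrite !in_itv/= !andbT.
have QA : A = ~` Q.
  apply/seteqP; split => p; rewrite /A /Q/=.
    by move=> [p0|p0] [? ?]; lra.
  move=> nQ; have [?|p1] := leP p.1 0; first by left.
  by have [?|p2] := leP p.2 0; [right|case: nQ].
have mA : measurable A by rewrite QA; exact: measurableC.
rewrite AQ ge0_integral_setU//=.
- rewrite /bqnl; apply: leeD quad.
  by rewrite le_eqVlt; apply/orP; left; apply/eqP; apply: eq_integral => p _;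
    rewrite expr2 mulrA.
- by rewrite -AQ; exact: measurable_nonlocal_density.
- by move=> p _; exact: nonlocal_density_ge0.
- by rewrite QA; apply/disj_set2P; rewrite setICl.
Qed.
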